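(* Let $d\ge3$, $N\ge1$, and let the inverse temperature $\beta>0$ be finite. Let $\mathbf p$ be a probability vector on $d$ levels and let $i_1,i_2,i_3$ be distinct levels that are consecutive neighbours in the $\beta$-order of $\mathbf p$: $\pi_{\mathbf p}(i_3)=\pi_{\mathbf p}(i_2)+1=\pi_{\mathbf p}(i_1)+2$. Let $\Pi=\Pi_{i_1i_3}\Pi_{i_2i_3}$, let $\Pi_{\mathbf p}$ be the permutation matrix of $\pi_{\mathbf p}$, let $\pi'$ be the permutation with matrix $\Pi'=\Pi\,\Pi_{\mathbf p}$, and let $\mathbf p^{\pi'}$ be the corresponding extreme point of $C^{\mathrm{TO}}_+(\mathbf p)$. Using an $N$-dimensional memory with trivial Hamiltonian, let $\widetilde{\mathcal P}^{\Pi}=\mathcal T\circ\widetilde{\mathcal P}^{(i_1i_3)}\circ\widetilde{\mathcal P}^{(i_2i_3)}$. Then $$\widetilde{\mathcal P}^{\Pi}(\mathbf p\otimes\boldsymbol\eta_M)=\mathbf q\otimes\boldsymbol\eta_M\quad\text{with}\quad \delta\big(\mathbf q,\mathbf p^{\pi'}\big)\xrightarrow{N\to\infty}0.$$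
   Context: Setting: a $d$-level system with energies $E_1,\dots,E_d$ and thermal distribution $\gamma_a=e^{-\beta E_a}/\sum_b e^{-\beta E_b}$; an $N$-dimensional memory with trivial Hamiltonian and thermal state $\boldsymbol\eta_M=(1/N,\dots,1/N)$. Joint states are probability vectors $\mathbf Q$ of length $dN$, entry $(a-1)N+k$ corresponding to system level $a$ and memory level $k$; joint thermal distribution $\Gamma_{(a-1)N+k}=\gamma_a/N$. $\Pi_{ij}$ is the permutation matrix transposing $i,j$. Two-level thermalisation $T_{xy}$: $Q_x\mapsto (Q_x+Q_y)\Gamma_x/(\Gamma_x+\Gamma_y)$, $Q_y\mapsto (Q_x+Q_y)\Gamma_y/(\Gamma_x+\Gamma_y)$, other entries unchanged. Round $\mathcal R^{(ij)}_k$ ($k=1,\dots,N$): apply sequentially, for $l=1,\dots,N$, $T_{(j-1)N+k,\,(i-1)N+l}$. $\widetilde{\mathcal P}^{(ij)}=\mathcal R^{(ij)}_N\circ\cdots\circ\mathcal R^{(ij)}_1$. Memory thermalisation $\mathcal T(\mathbf Q)=\mathbf q\otimes\boldsymbol\eta_M$, $q_a=\sum_kQ_{(a-1)N+k}$. $\beta$-order: $\pi_{\mathbf p}$ is the permutation arranging $(p_1/\gamma_1,\dots,p_d/\gamma_d)$ in non-increasing order, $\pi_{\mathbf p}(a)$ being the position of level $a$; $\Pi_{\mathbf p}$ is its matrix, so $\Pi_{\mathbf p}\mathbf p=(p_{\pi_{\mathbf p}^{-1}(1)},\dots,p_{\pi_{\mathbf p}^{-1}(d)})$. Thermomajorisation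 curve $f^\beta_{\mathbf p}$: the piecewise linear curve on $[0,1]$ joining $(0,0)$ and the points $\big(\sum_{l=1}^k\gamma_{\pi_{\mathbf p}^{-1}(l)},\sum_{l=1}^kp_{\pi_{\mathbf p}^{-1}(l)}\big)$, $k=1,\dots,d$. $C^{\mathrm{TO}}_+(\mathbf p)$ is the set of $\mathbf q$ with $f^\beta_{\mathbf p}\ge f^\beta_{\mathbf q}$ on $[0,1]$ (states reachable by thermal operations). For a permutation $\pi$ of $\{1,\dots,d\}$ the point $\mathbf p^{\pi}$ is defined by $x_k=\sum_{l=1}^k\gamma_{\pi^{-1}(l)}$, $y_k=f^\beta_{\mathbf p}(x_k)$, $y_0=0$, and $p^{\pi}_a=y_{\pi(a)}-y_{\pi(a)-1}$; these are the extreme points of $C^{\mathrm{TO}}_+(\mathbf p)$. Total variation distance: $\delta(\mathbf p,\mathbf q)=\frac12\sum_a|p_a-q_a|$.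
   Formalization: The order π' is taken as π'(a)=π_p(τ_{i2i3}(τ_{i1i3}(a))), so i3,i1,i2 occupy the positions of i1,i2,i3; the literal product Π Π_p acts on positions and fails, e.g. for equal energies, d=3, p=(.5,.3,.2), π_p=id. *)

(* Defs.v *)
From HB Require Import structures.
From mathcomp Require Import all_boot all_order all_algebra all_fingroup.
From mathcomp Require Import all_classical all_reals all_analysis.
Set Implicit Arguments.
Unset Strict Implicit.
Unset Printing Implicit Defensive.
Import Order.TTheory GRing.Theory Num.Theory.
Local Open Scope ring_scope.

Section Defs.
Variable R : realType.

Definition gibbs (d : nat) (beta : R) (E : 'I_d -> R) (a : 'I_d) : R :=
  expR (- (beta * E a)) / \sum_(b < d) expR (- (beta * E b)).

Definition is_prob (d : nat) (p : 'I_d -> R) : Prop :=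
  (forall a, 0 <= p a) /\ \sum_(a < d) p a = 1.

(* pi is a beta-order of p (pi a = 0-based position of level a):
   the ratios p_a/gamma_a are arranged in non-increasing order *)
Definition is_beta_order (d : nat) (g p : 'I_d -> R) (pi : 'S_d) : Prop :=
  forall a b : 'I_d, (pi a < pi b)%N -> p b / g b <= p a / g a.

Definition vertex_x (d : nat) (g : 'I_d -> R) (pi : 'S_d) (k : nat) : R :=
  \sum_(b < d | (pi b < k)%N) g b.

Definition clamp01 (t : R) : R := if t < 0 then 0 else if 1 < t then 1 else t.

(* thermomajorisation curve f^beta_p: the piecewise linear curve joining (0,0)
   and the points (vertex_x k, sum of p over the first k levels in the
   beta-order pi); written as the sum of the contributions of each segment. *)
Definition thermo_curve (d : nat) (g p : 'I_d -> R) (pi : 'S_d) (x : R) : R :=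
  \sum_(a < d) p a * clamp01 ((x - vertex_x g pi (pi a)) / g a).

Definition extreme_point (d : nat) (g p : 'I_d -> R) (pip pi' : 'S_d)
    (a : 'I_d) : R :=
  thermo_curve g p pip (vertex_x g pi' (pi' a).+1)
  - thermo_curve g p pip (vertex_x g pi' (pi' a)).

Definition tv_dist (d : nat) (p q : 'I_d -> R) : R :=
  2^-1 * \sum_(a < d) `|p a - q a|.

(* ----- system + memory. The joint level (a,k) is the paper's (a-1)N+k. *)
Definition joint (d N : nat) := ('I_d * 'I_N)%type.

Definition joint_gibbs (d N : nat) (g : 'I_d -> R) (z : joint d N) : R :=
  g z.1 / N%:R.

Definition eta_M (N : nat) (k : 'I_N) : R := N%:R^-1.

Definition tensor (d N : nat) (q : 'I_d -> R) (z : joint d N) : R :=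
  q z.1 * eta_M z.2.

Definition therm2 (d N : nat) (G : joint d N -> R) (x y : joint d N)
    (Q : joint d N -> R) : joint d N -> R :=
  fun z => if z == x then (Q x + Q y) * G x / (G x + G y)
           else if z == y then (Q x + Q y) * G y / (G x + G y)
           else Q z.

Definition round (d N : nat) (G : joint d N -> R) (i j : 'I_d) (k : 'I_N)
    (Q : joint d N -> R) : joint d N -> R :=
  foldl (fun Q' l => therm2 G (j, k) (i, l) Q') Q (enum 'I_N).

Definition protocol (d N : nat) (G : joint d N -> R) (i j : 'I_d)
    (Q : joint d N -> R) : joint d N -> R :=
  foldl (fun Q' k => round G i j k Q') Q (enum 'I_N).

Definition marginal (d N : nat) (Q : joint d N -> R) (a : 'I_d) : R :=
  \sum_(k < N) Q (a, k).

Definition mem_therm (d N : nat) (Q : joint d N -> R) : joint d N -> R :=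
  tensor (marginal Q).

Definition protocol_Pi (d N : nat) (g : 'I_d -> R) (i1 i2 i3 : 'I_d)
    (Q : joint d N -> R) : joint d N -> R :=
  mem_therm (protocol (joint_gibbs g) i1 i3
               (protocol (joint_gibbs g) i2 i3 Q)).

End Defs.

(* Main.v *)
(** In units of the Gibbs weight, a two-level thermalisation replaces the two
    values by their weighted average. Hence the value [c(k,l)] shared by the
    k-th memory copy of level j and the l-th copy of level i after their meeting
    satisfies [(gi + gj) c(k+1,l+1) = gj c(k+1,l) + gi c(k,l+1)]: it is the mean
    of the boundary data over a backward lattice walk. For this walk both
    [X = gj k - gi l] and [X^2 + gi gj (k + l)] are martingales, so the walk
    leaves the quadrant at a point whose [X] is within O(sqrt N) of the initial
    one. The boundary data are step functions, but their partial sums over k,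
    which are the populations of interest, obey the same recursion (up to a term
    linear in l) with Lipschitz boundary data; so they differ from a piecewise
    linear profile of [X] by O(sqrt N). Feeding the first protocol into the
    second one composes the profiles and yields a rate O(1 / sqrt N). *)

Require Import Defs.
From HB Require Import structures.
From mathcomp Require Import all_boot all_order all_algebra all_fingroup.
From mathcomp Require Import all_classical all_reals all_analysis.
From mathcomp Require Import zify ring lra.
Set Implicit Arguments.
Unset Strict Implicit.
Unset Printing Implicit Defensive.
Import Order.TTheory GRing.Theory Num.Theory.
Import numFieldNormedType.Exports.
Local Open Scope classical_set_scope.
Local Open Scope ring_scope.

(** * Lattice recursion and its martingale bound *)

Section Lattice.
Variables (R : realFieldType) (gi gj : R).
Hypotheses (gi_gt0 : 0 < gi) (gj_gt0 : 0 < gj).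

Definition lattice_harmonic (F : nat -> nat -> R) : Prop :=
  forall k l, (gi + gj) * F k.+1 l.+1 = gj * F k.+1 l + gi * F k l.+1.

Definition lipschitz_with (L : R) (Phi : R -> R) : Prop :=
  forall x y, `|Phi x - Phi y| <= L * `|x - y|.

(* The bound solves the recursion exactly, since [(X - x0)^2 + gi gj (k + l)] with
   [X = gj k - gi l] does, and dominates on the boundary by AM-GM. For [x0 = X] and
   [del] of order sqrt(k + l), the error beyond [eps] is of order sqrt(k + l). *)
Lemma lattice_harmonic_deviation (F : nat -> nat -> R) (Phi : R -> R)
    (L eps del : R) (n : nat) :
  lattice_harmonic F -> lipschitz_with L Phi -> 0 <= L -> 0 < del ->
  (forall l, `|F 0 l - Phi (- (gi * l%:R))| <= eps) ->
  (forall k, (k <= n)%N -> `|F k 0 - Phi (gj * k%:R)| <= eps) ->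
  forall x0 k l, (k <= n)%N ->
    `|F k l - Phi x0| <= eps + L / 2 *
      (((gj * k%:R - gi * l%:R - x0) ^+ 2 + gi * gj * (k%:R + l%:R)) / del + del).
Proof.
move=> Fharm PhiL L0 del0 F0l Fk0 x0.
have edge k l : `|F k l - Phi (gj * k%:R - gi * l%:R)| <= eps ->
    `|F k l - Phi x0| <= eps + L / 2 *
      (((gj * k%:R - gi * l%:R - x0) ^+ 2 + gi * gj * (k%:R + l%:R)) / del + del).
  move=> Fkl; set x := gj * k%:R - gi * l%:R in Fkl *.
  apply: le_trans (ler_distD (Phi x) _ _) _.
  apply: lerD Fkl (le_trans (PhiL _ _) _).
  rewrite -mulrA; apply: ler_wpM2l => //.
  rewrite -[(x - x0) ^+ 2]real_normK ?num_real //; set t := `|x - x0|.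
  set M := gi * gj * _; have M0 : 0 <= M.
    by rewrite !mulr_ge0 ?addr_ge0 ?ler0n // ltW.
  have -> : 2^-1 * ((t ^+ 2 + M) / del + del) = t + ((t - del) ^+ 2 + M) / (2 * del).
    by field; exact: lt0r_neq0.
  rewrite lerDl divr_ge0 ?addr_ge0 ?sqr_ge0 ?mulr_ge0 ?ler0n //; exact: ltW.
move=> k; elim: k => [|k IHk] l kn.
  by apply: edge; rewrite mulr0 sub0r.
elim: l => [|l IHl].
  by apply: edge; rewrite mulr0 subr0 Fk0.
have := IHk l.+1 (ltnW kn); have := IHl.
have s0 : 0 < gi + gj by rewrite addr_gt0.
set B1 := (X in _ <= X) => H1; set B2 := (X in _ <= X) => H2.
set B := (X in _ <= X).
have BE : (gi + gj) * B = gj * B1 + gi * B2.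
  rewrite /B /B1 /B2 -!natr1; field; exact: lt0r_neq0.
have FE : (gi + gj) * (F k.+1 l.+1 - Phi x0) =
    gj * (F k.+1 l - Phi x0) + gi * (F k l.+1 - Phi x0).
  by rewrite mulrBr Fharm; ring.
rewrite -(ler_pM2l s0) BE -[X in X * `|_|](gtr0_norm s0) -normrM FE.
apply: le_trans (ler_normD _ _) _.
rewrite !normrM (gtr0_norm gi_gt0) (gtr0_norm gj_gt0).
by apply: lerD; rewrite ler_pM2l.
Qed.

Variables (w : R) (u : nat -> R).

(** Copies are counted from 1, leaving index 0 for the initial ratios: row 0 holds the constant [w]
    of the copies of i, column 0 the data [u] of the copies of j, whence [u k'] in row [k'.+1]. The
    recursion never reads the corner. *)
Fixpoint grid (k : nat) : nat -> R :=
  if k is k'.+1 then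
    fix row (l : nat) : R :=
      if l is l'.+1 then (gj * row l' + gi * grid k' l) / (gi + gj) else u k'
  else fun=> w.

Lemma gridSS k l :
  grid k.+1 l.+1 = (gj * grid k.+1 l + gi * grid k l.+1) / (gi + gj).
Proof. by []. Qed.

(* Subtracting the linear term absorbs the boundary value [w] that enters the
   recursion for the partial sums at each step in l. *)
Definition grid_excess (k l : nat) : R :=
  gj * (\sum_(h < k) grid h.+1 l) - gi * w * l%:R.

Lemma grid_excess_harmonic : lattice_harmonic grid_excess.
Proof.
move=> k l; rewrite /grid_excess.
have s0 : gi + gj != 0 by rewrite lt0r_neq0 ?addr_gt0.
have -> : \sum_(h < k.+1) grid h.+1 l.+1 =
    (gj * (\sum_(h < k.+1) grid h.+1 l) +
     gi * (w + \sum_(h < k) grid h.+1 l.+1)) / (gi + gj).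
  (* Summing the recursion over rows shifts its second term by one row, so row 0 contributes one
     [w]. *)
  have -> : w + \sum_(h < k) grid h.+1 l.+1 = \sum_(h < k.+1) grid h l.+1.
    by rewrite big_ord_recl.
  by rewrite !mulr_sumr -big_split mulr_suml; apply: eq_bigr => h _.
by rewrite -natr1; field.
Qed.

End Lattice.
Arguments grid : simpl never.

(** * Identification of the protocol with the grid *)

Lemma foldl_enum_ord (N : nat) (T : Type) (f : T -> 'I_N -> T) (s : nat -> T) :
  (forall k : 'I_N, f (s k) k = s k.+1) -> foldl f (s 0) (enum 'I_N) = s N.
Proof.
move=> fs.
suff take_s m : (m <= N)%N -> foldl f (s 0) (take m (enum 'I_N)) = s m.
  by rewrite -(take_s N) // take_oversize ?size_enum_ord.
elim: m => [|m IHm] mN; first by rewrite take0.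
rewrite (take_nth (Ordinal mN)) ?size_enum_ord // foldl_rcons IHm ?(ltnW mN) //.
by rewrite (nth_ord_enum (Ordinal mN) (Ordinal mN)) (fs (Ordinal mN)).
Qed.

Section ProtocolGrid.
Variables (R : realType) (d N : nat) (g : 'I_d -> R) (i j : 'I_d).
Hypotheses (g_gt0 : forall a, 0 < g a) (N_gt0 : (0 < N)%N) (neq_ij : i != j).
Variables (w : R) (u : nat -> R) (Q : joint d N -> R).
Hypothesis Qi : forall l, Q (i, l) = g i / N%:R * w.
Hypothesis Qj : forall k : 'I_N, Q (j, k) = g j / N%:R * u k.

Let c := grid (g i) (g j) w u.

(* The state after k complete rounds and l steps of the next one. *)
Definition protocol_stage (k l : nat) (z : joint d N) : R :=
  if z.1 == j then g j / N%:R *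
    (if (z.2 < k)%N then c z.2.+1 N else if (z.2 == k :> nat) then c k.+1 l else u z.2)
  else if z.1 == i then g i / N%:R * (if (z.2 < l)%N then c k.+1 z.2.+1 else c k z.2.+1)
  else Q z.

(** The two ratios that meet are [c k.+1 l] and [c k l.+1]; their Gibbs-weighted mean is
    [c k.+1 l.+1], and no other entry moves. *)
Lemma therm2_protocol_stage (k l : 'I_N) :
  therm2 (joint_gibbs g) (j, k) (i, l) (protocol_stage k l) = protocol_stage k l.+1.
Proof.
have N0 : N%:R != 0 :> R by rewrite pnatr_eq0 -lt0n.
have s0 : g i + g j != 0 by rewrite lt0r_neq0 ?addr_gt0.
have s0' : g j + g i != 0 by rewrite addrC.
have Ex : protocol_stage k l (j, k) = g j / N%:R * c k.+1 l.
  by rewrite /protocol_stage /= eqxx ltnn eqxx.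
have Ey : protocol_stage k l (i, l) = g i / N%:R * c k l.+1.
  by rewrite /protocol_stage /= (negPf neq_ij) eqxx ltnn.
apply/funext => -[a m]; rewrite /therm2 Ex Ey /joint_gibbs /= !xpair_eqE.
rewrite /protocol_stage /=; case: (eqVneq a j) => [->|naj] /=.
  rewrite [j == i]eq_sym (negPf neq_ij) /=.
  case: (eqVneq m k) => [->|nmk]; last by rewrite -val_eqE /= in nmk; rewrite (negPf nmk).
  by rewrite ltnn eqxx /c gridSS; field; rewrite ?N0 ?s0 ?s0'.
case: (eqVneq a i) => //= _; case: (eqVneq m l) => [->|nml].
  by rewrite ltnSn /c gridSS; field; rewrite ?N0 ?s0 ?s0'.
by rewrite -val_eqE /= in nml; rewrite ltnS [(m <= l)%N]leq_eqVlt (negPf nml).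
Qed.

Lemma protocolE :
  protocol (joint_gibbs g) i j Q = protocol_stage N 0.
Proof.
(* Before any meeting the copies of i read row 0 and those of j read [u]. *)
rewrite /protocol; have -> : Q = protocol_stage 0 0.
  apply/funext => -[a m]; rewrite /protocol_stage /=.
  case: eqP => [->|_]; last by case: eqP => [->|].
  by rewrite Qj; case: eqP => // ->.
apply: (@foldl_enum_ord N _ _ (protocol_stage^~ 0)) => k.
rewrite /round (@foldl_enum_ord N _ _ (protocol_stage k)) => [|l]; last first.
  exact: therm2_protocol_stage.
(* End of a round: the current copy of j is frozen at [c k.+1 N], and the next one starts from
   column 0, where the grid equals [u]. *)
apply/funext => -[a m]; rewrite /protocol_stage /= ltnS [(m <= k)%N]leq_eqVlt ltn_ord.
case: eqP => // _; case: (ltngtP m k) => [||->] //= km.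
by case: eqP => // ->.
Qed.

Lemma protocol_grid k : protocol (joint_gibbs g) i j Q (j, k) = g j / N%:R * c k.+1 N.
Proof. by rewrite protocolE /protocol_stage /= eqxx ltn_ord. Qed.

End ProtocolGrid.

(** * Populations preserved by a protocol *)

Section Conservation.
Variables (R : realType) (d N : nat) (G : joint d N -> R) (i j : 'I_d).
Hypotheses (G_gt0 : forall z, 0 < G z) (neq_ij : i != j).

Lemma therm2_off (k l : 'I_N) (Q : joint d N -> R) a m : a != i -> a != j ->
  therm2 G (j, k) (i, l) Q (a, m) = Q (a, m).
Proof. by move=> /negPf ai /negPf aj; rewrite /therm2 !xpair_eqE ai aj. Qed.

Lemma therm2_marginal (k l : 'I_N) (Q : joint d N -> R) :
  marginal (therm2 G (j, k) (i, l) Q) i + marginal (therm2 G (j, k) (i, l) Q) j =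
  marginal Q i + marginal Q j.
Proof.
rewrite /marginal (bigD1 l) // (bigD1 k (P := xpredT)) //=.
rewrite [in RHS](bigD1 l) // [in RHS](bigD1 k (P := xpredT)) //=.
have -> : \sum_(m | m != l) therm2 G (j, k) (i, l) Q (i, m) = \sum_(m | m != l) Q (i, m).
  by apply: eq_bigr => m /negPf ml; rewrite /therm2 !xpair_eqE (negPf neq_ij) ml andbF.
have -> : \sum_(m | m != k) therm2 G (j, k) (i, l) Q (j, m) = \sum_(m | m != k) Q (j, m).
  apply: eq_bigr => m /negPf mk.
  by rewrite /therm2 !xpair_eqE mk andbF [j == i]eq_sym (negPf neq_ij).
rewrite /therm2 !eqxx xpair_eqE (negPf neq_ij) /=.
have := lt0r_neq0 (addr_gt0 (G_gt0 (j, k)) (G_gt0 (i, l))) => s0.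
by field.
Qed.

Lemma protocol_ind (P : (joint d N -> R) -> Prop) (Q : joint d N -> R) :
  (forall k l Q', P Q' -> P (therm2 G (j, k) (i, l) Q')) -> P Q -> P (protocol G i j Q).
Proof.
move=> step; rewrite /protocol; elim: (enum 'I_N) Q => //= k s IHs Q PQ.
apply: IHs; rewrite /round; elim: (enum 'I_N) Q PQ => //= l t IHt Q PQ.
exact/IHt/step.
Qed.

Lemma protocol_off (Q : joint d N -> R) a m : a != i -> a != j ->
  protocol G i j Q (a, m) = Q (a, m).
Proof.
move=> ai aj; apply: (@protocol_ind (fun Q' => Q' (a, m) = Q (a, m))) => // k l Q' <-.
exact: therm2_off.
Qed.

(** Thanks to this balance only the population of j has to be computed through the grid; that of i
    follows. *)
Lemma protocol_marginal (Q : joint d N -> R) :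
  marginal (protocol G i j Q) i + marginal (protocol G i j Q) j = marginal Q i + marginal Q j.
Proof.
apply: (@protocol_ind (fun Q' =>
  marginal Q' i + marginal Q' j = marginal Q i + marginal Q j)) => // k l Q' <-.
exact: therm2_marginal.
Qed.

End Conservation.

(** * Limit profiles and error estimates *)

Section Estimate.
Variable R : realType.

(** For [B >= 0], the continuous piecewise linear function vanishing at 0 with slopes [w1] below 0,
    [w2] on [0, B] and [w3] beyond; [B = 0] leaves a single break. *)
Definition profile (B w1 w2 w3 x : R) : R :=
  w1 * Num.min x 0 + w2 * Num.min (Num.max x 0) B + w3 * Num.max (x - B) 0.

(** The constant is uniform in [B], which grows with the memory in the second stage. *)
Lemma profile_lipschitz B w1 w2 w3 :
  lipschitz_with (`|w1| + `|w2| + `|w3|) (profile B w1 w2 w3).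
Proof.
move=> x y.
have min_lip (c a b : R) : `|Num.min a c - Num.min b c| <= `|a - b|.
  by case: (leP a c); case: (leP b c) => ? ?; case: (ger0P (a - b)) => ?;
    rewrite ?ler_norml; try (apply/andP; split); lra.
have max_lip (c a b : R) : `|Num.max a c - Num.max b c| <= `|a - b|.
  by case: (leP a c); case: (leP b c) => ? ?; case: (ger0P (a - b)) => ?;
    rewrite ?ler_norml; try (apply/andP; split); lra.
have -> : profile B w1 w2 w3 x - profile B w1 w2 w3 y =
   w1 * (Num.min x 0 - Num.min y 0)
   + w2 * (Num.min (Num.max x 0) B - Num.min (Num.max y 0) B)
   + w3 * (Num.max (x - B) 0 - Num.max (y - B) 0) by rewrite /profile; ring.
rewrite (le_trans (ler_normD _ _)) // !mulrDl lerD //; last first.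
  rewrite normrM ler_wpM2l // (le_trans (max_lip _ _ _)) //.
  by rewrite opprB addrA subrK.
rewrite (le_trans (ler_normD _ _)) // lerD // normrM ler_wpM2l //.
exact: le_trans (min_lip _ _ _) (max_lip _ _ _).
Qed.

(** Carries the estimates at scale n over to limits free of n. *)
Lemma profile_homogeneous B w1 w2 w3 x t : 0 <= t ->
  profile (B * t) w1 w2 w3 (x * t) = t * profile B w1 w2 w3 x.
Proof.
move=> t0; have minM a b : Num.min (a * t) (b * t) = t * Num.min a b :> R.
  by rewrite -minr_pMl // mulrC.
have maxM a b : Num.max (a * t) (b * t) = t * Num.max a b :> R.
  by rewrite -maxr_pMl // mulrC.
have minM0 a : Num.min (a * t) 0 = t * Num.min a 0 :> R by rewrite -minM mul0r.
have maxM0 a : Num.max (a * t) 0 = t * Num.max a 0 :> R by rewrite -maxM mul0r.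
by rewrite /profile -mulrBl minM0 !maxM0 [t * Num.max x 0]mulrC minM; ring.
Qed.

Lemma profile_neg B w1 w2 w3 x : 0 <= B -> x <= 0 -> profile B w1 w2 w3 x = w1 * x.
Proof.
move=> B0 x0; rewrite /profile (min_l x0) (max_r x0) (min_l B0) max_r; first by ring.
lra.
Qed.

Lemma grid_excess_estimate (gi gj w : R) (u : nat -> R) (n : nat) (Phi : R -> R)
    (L eps : R) :
  0 < gi -> 0 < gj -> (0 < n)%N -> 0 <= L -> 0 <= eps -> lipschitz_with L Phi ->
  (forall x, x <= 0 -> Phi x = w * x) ->
  (forall k, (k <= n)%N -> `|gj * (\sum_(h < k) u h) - Phi (gj * k%:R)| <= eps) ->
  forall k, (k <= n)%N ->
    `|grid_excess gi gj w u k n - Phi (gj * k%:R - gi * n%:R)|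
      <= eps + L / 2 * (2 * (gi * gj) + 1) * Num.sqrt n%:R.
Proof.
move=> gi0 gj0 n0 L0 eps0 PhiL Phineg Phipos k kn.
have s0 : 0 < Num.sqrt n%:R :> R by rewrite sqrtr_gt0 ltr0n.
have sn : n%:R = Num.sqrt n%:R ^+ 2 :> R by rewrite sqr_sqrtr.
apply: le_trans (lattice_harmonic_deviation gi0 gj0 (n := n) (eps := eps)
  (grid_excess_harmonic gi0 gj0 w u) PhiL L0 s0 _ _ _ _ kn) _.
(* On the edge k = 0 the excess is exactly [- gi * w * l], which is [Phi] there because its slope is
   [w] on the negative side. *)
- move=> l; rewrite /grid_excess big_ord0 mulr0 sub0r Phineg; last first.
    by rewrite oppr_le0 mulr_ge0 // ltW.
  by rewrite [X in `|X|](_ : _ = 0) ?normr0 //; ring.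
- by move=> m mn; rewrite /grid_excess mulr0 subr0; apply: Phipos.
(* Centred at the starting point of the walk, the square vanishes. With [del] equal to sqrt n and k
   <= n, the remaining quotient is at most 2 gi gj sqrt n. *)
rewrite lerD2l -[leRHS]mulrA; apply: ler_wpM2l; first exact: divr_ge0.
rewrite subrr expr0n /= add0r mulrDl mul1r lerD2r ler_pdivrMr // -[leRHS]mulrA -expr2 -sn.
rewrite [2 * _]mulrC -[leRHS]mulrA; apply: ler_wpM2l; first by rewrite mulr_ge0 ?ltW.
have : k%:R <= n%:R :> R by rewrite ler_nat.
by move=> ?; lra.
Qed.

Section TwoStages.
Variables (g1 g2 g3 u1 u2 u3 : R).
Hypotheses (g1_gt0 : 0 < g1) (g2_gt0 : 0 < g2) (g3_gt0 : 0 < g3).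

(** The large-memory populations of the third level after the first and the second protocol, [u1],
    [u2], [u3] being the initial ratios to the Gibbs weights. *)
Definition first_stage_limit : R := g2 * u2 + profile 0 u2 u2 u3 (g3 - g2).
Definition second_stage_limit : R := g1 * u1 + profile g2 u1 u2 u3 (g3 - g1).

Let L := `|u1| + `|u2| + `|u3|.
Let L' := `|u2| + `|u2| + `|u3|.
Let K1 := L' / 2 * (2 * (g2 * g3) + 1).
Let K2 := L / 2 * (2 * (g1 * g3) + 1).
Let c1 n := grid g2 g3 u2 (fun=> u3) ^~ n.
Let c2 n := grid g1 g3 u1 (fun k => c1 n k.+1) ^~ n.

(** The initial ratios are constant on each level, so the boundary data fit the profile without
    error. All partial sums are bounded, since they are the boundary data of the second stage. *)
Lemma first_stage_estimate n k : (0 < n)%N -> (k <= n)%N ->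
  `|g3 * (\sum_(h < k) c1 n h.+1)
    - (g2 * u2 * n%:R + profile 0 u2 u2 u3 (g3 * k%:R - g2 * n%:R))|
   <= K1 * Num.sqrt n%:R.
Proof.
move=> n0 kn; rewrite opprD addrA -[K1 * _]add0r.
apply: (grid_excess_estimate (u := fun=> u3)) => //.
- by rewrite /L' !addr_ge0.
- exact: profile_lipschitz.
- by move=> x x0; rewrite profile_neg.
move=> m _; rewrite sumr_const card_ord /profile.
have x0 : 0 <= g3 * m%:R by rewrite mulr_ge0 // ltW.
rewrite (min_r x0) (max_l x0) (min_r x0) subr0 (max_l x0) -mulr_natr.
by rewrite [X in `|X|](_ : _ = 0) ?normr0 //; ring.
Qed.

(** The error of the first stage enters as the boundary error [eps], so the two constants add up. *)
Lemma second_stage_estimate n k : (0 < n)%N -> (k <= n)%N ->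
  `|g3 * (\sum_(h < k) c2 n h.+1)
    - (g1 * u1 * n%:R + profile (g2 * n%:R) u1 u2 u3 (g3 * k%:R - g1 * n%:R))|
   <= (K1 + K2) * Num.sqrt n%:R.
Proof.
move=> n0 kn; rewrite opprD addrA mulrDl.
have B0 : 0 <= g2 * n%:R by rewrite mulr_ge0 // ltW.
apply: (grid_excess_estimate (u := fun k => c1 n k.+1)) => //.
- by rewrite /L !addr_ge0.
- have K1_ge0 : 0 <= K1.
    apply: mulr_ge0; first by rewrite divr_ge0 // !addr_ge0.
    by rewrite addr_ge0 // mulr_ge0 // mulr_ge0 // ltW.
  by rewrite mulr_ge0 ?sqrtr_ge0.
- exact: profile_lipschitz.
- by move=> x x0; rewrite profile_neg.
(* On x >= 0, the two-slope profile shifted by [B] and raised by [u2 * B] is the three-slope profile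
   with break at [B]: this composes the stages. *)
move=> m mn; rewrite (_ : profile _ _ _ _ _ =
  g2 * u2 * n%:R + profile 0 u2 u2 u3 (g3 * m%:R - g2 * n%:R)).
  exact: first_stage_estimate.
have x0 : 0 <= g3 * m%:R by rewrite mulr_ge0 // ltW.
rewrite /profile (min_r x0) (max_l x0) subr0.
set x := g3 * m%:R; set B := g2 * n%:R in B0 *.
rewrite (_ : g2 * u2 * _ = u2 * B); last by rewrite /B; ring.
case: (leP x B) => xB.
  have xB0 : x - B <= 0 by lra.
  by rewrite (max_r xB0) (min_l xB0) minxx; ring.
have xB0 : 0 <= x - B by lra.
by rewrite (max_l xB0) !(min_r xB0); ring.
Qed.

Let scaled_bound n (S X K : R) : (0 < n)%N ->
  `|g3 * S - X * n%:R| <= K * Num.sqrt n%:R ->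
  `|g3 / n%:R * S - X| <= K / Num.sqrt n%:R.
Proof.
move=> n0; have n0' : 0 < n%:R :> R by rewrite ltr0n.
have s0 : 0 < Num.sqrt n%:R :> R by rewrite sqrtr_gt0.
have sn : n%:R = Num.sqrt n%:R ^+ 2 :> R by rewrite sqr_sqrtr.
move=> H; rewrite -(ler_pM2r n0') -[X in _ * X <= _](gtr0_norm n0') -normrM.
rewrite (_ : (_ - _) * _ = g3 * S - X * n%:R); last by field; exact: lt0r_neq0.
apply: le_trans H _; rewrite [X in _ <= _ * X]sn -mulrA expr2 mulKf //.
exact: lt0r_neq0.
Qed.

Lemma first_stage_rate : exists K, forall n, (0 < n)%N ->
  `|g3 / n%:R * (\sum_(h < n) c1 n h.+1) - first_stage_limit| <= K / Num.sqrt n%:R.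
Proof.
exists K1 => n n0; apply: scaled_bound => //.
have := first_stage_estimate n0 (leqnn n).
have := profile_homogeneous 0 u2 u2 u3 (g3 - g2) (ler0n R n).
rewrite mul0r mulrBl => ->.
by rewrite /first_stage_limit mulrDl [profile _ _ _ _ _ * _]mulrC.
Qed.

Lemma second_stage_rate : exists K, forall n, (0 < n)%N ->
  `|g3 / n%:R * (\sum_(h < n) c2 n h.+1) - second_stage_limit| <= K / Num.sqrt n%:R.
Proof.
exists (K1 + K2) => n n0; apply: scaled_bound => //.
have := second_stage_estimate n0 (leqnn n).
rewrite -mulrBl profile_homogeneous ?ler0n //.
by rewrite /second_stage_limit [(_ + profile _ _ _ _ _) * _]mulrDl [profile _ _ _ _ _ * _]mulrC.
Qed.

End TwoStages.
End Estimate.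

(** * The thermomajorisation curve along three consecutive segments *)

Section Curve.
Variables (R : realType) (d : nat) (g p : 'I_d -> R).
Hypothesis g_gt0 : forall a, 0 < g a.

Lemma clamp01_le0 (t : R) : t <= 0 -> clamp01 t = 0.
Proof.
rewrite /clamp01 le_eqVlt => /orP[/eqP->|->//].
by rewrite ltxx ltNge ler01.
Qed.

Lemma clamp01_ge1 (t : R) : 1 <= t -> clamp01 t = 1.
Proof.
move=> t1; rewrite /clamp01 ltNge (le_trans ler01 t1) /=.
by case: ltP => // t1'; apply/eqP; rewrite eq_le t1 t1'.
Qed.

Lemma clamp01_div (c t : R) : 0 < c -> c * clamp01 (t / c) = Num.min (Num.max t 0) c.
Proof.
move=> c0; have [t0|t0] := leP t 0.
  by rewrite clamp01_le0 ?mulr0 ?(min_l (ltW c0)) // pmulr_lle0 ?invr_gt0.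
have [tc|ct] := ltP t c.
  rewrite /clamp01 ltNge divr_ge0 ?(ltW t0) ?(ltW c0) //= ltr_pdivlMr // mul1r.
  by rewrite ltNge (ltW tc) /= mulrC divfK ?lt0r_neq0.
by rewrite clamp01_ge1 ?mulr1 // ler_pdivlMr // mul1r.
Qed.

Lemma vertex_xS (pi : 'S_d) a : vertex_x g pi (pi a).+1 = vertex_x g pi (pi a) + g a.
Proof.
rewrite /vertex_x (bigD1 a) ?ltnSn //= addrC; congr (_ + _); apply: eq_bigl => b.
by rewrite ltnS ltn_neqAle -(inj_eq (@perm_inj _ pi)) andbC.
Qed.

Lemma vertex_x_mono (pi : 'S_d) k m : (k <= m)%N -> vertex_x g pi k <= vertex_x g pi m.
Proof.
move=> km; rewrite /vertex_x [leRHS](bigID (fun b => (pi b < k)%N)) /=.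
rewrite [X in _ <= X + _](eq_bigl (fun b => (pi b < k)%N)) => [|b]; last first.
  by case: (ltnP (pi b) k) => [bk|]; rewrite ?andbF // (leq_trans bk km).
by rewrite lerDl sumr_ge0 // => b _; apply: ltW.
Qed.

Lemma clamp01_before (pi : 'S_d) k x b : (pi b < k)%N -> vertex_x g pi k <= x ->
  clamp01 ((x - vertex_x g pi (pi b)) / g b) = 1.
Proof.
move=> bk kx; apply: clamp01_ge1; rewrite ler_pdivlMr // mul1r lerBrDl -vertex_xS.
exact: le_trans (vertex_x_mono pi bk) kx.
Qed.

Lemma clamp01_after (pi : 'S_d) k x b : (k <= pi b)%N -> x <= vertex_x g pi k ->
  clamp01 ((x - vertex_x g pi (pi b)) / g b) = 0.
Proof.
move=> kb xk; apply: clamp01_le0; rewrite pmulr_lle0 ?invr_gt0 // subr_le0.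
exact: le_trans xk (vertex_x_mono pi kb).
Qed.

(** At a vertex every segment is either completely covered or not yet entered, so each clamp is 1 or
    0. *)
Lemma thermo_curve_vertex (pi : 'S_d) k :
  thermo_curve g p pi (vertex_x g pi k) = \sum_(b < d | (pi b < k)%N) p b.
Proof.
rewrite [RHS]big_mkcond; apply: eq_bigr => b _; case: ltnP => bk.
  by rewrite (clamp01_before bk) ?mulr1.
by rewrite (clamp01_after bk) ?mulr0.
Qed.

Lemma thermo_curve_vertexS (pi : 'S_d) a :
  thermo_curve g p pi (vertex_x g pi (pi a).+1)
  - thermo_curve g p pi (vertex_x g pi (pi a)) = p a.
Proof.
rewrite !thermo_curve_vertex (bigD1 a) ?ltnSn //= (eq_bigl (fun b => (pi b < pi a)%N)).
  by rewrite addrK.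
by move=> b; rewrite ltnS ltn_neqAle -(inj_eq (@perm_inj _ pi)) andbC.
Qed.

Variables (pip : 'S_d) (i1 i2 i3 : 'I_d).
Hypothesis pos3 : (pip i3 : nat) = (pip i2).+1.
Hypothesis pos2 : (pip i2 : nat) = (pip i1).+1.

Lemma consecutive_neq : [/\ i1 != i2, i1 != i3 & i2 != i3].
Proof. by split; apply/eqP => E; move: pos3 pos2; rewrite E; lia. Qed.

(** Products apply their left factor first, so the block i1, i2, i3 is reordered as i3, i1, i2. *)
Let pi' : 'S_d := (tperm i1 i3 * tperm i2 i3 * pip)%g.
Let x0 := vertex_x g pip (pip i1).
Let u a := p a / g a.

Lemma cycled_order1 : pi' i1 = pip i2.
Proof. by rewrite !permM tpermL tpermR. Qed.

Lemma cycled_order2 : pi' i2 = pip i3.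
Proof.
have [n12 n13 n23] := consecutive_neq.
by rewrite !permM (tpermD n12) 1?eq_sym // tpermL.
Qed.

Lemma cycled_order3 : pi' i3 = pip i1.
Proof.
have [n12 n13 n23] := consecutive_neq.
by rewrite !permM tpermR tpermD // eq_sym.
Qed.

Lemma cycled_order_off b : b != i1 -> b != i2 -> b != i3 -> pi' b = pip b.
Proof. by move=> b1 b2 b3; rewrite !permM !tpermD // eq_sym. Qed.

(** The reordering stays inside the block, so an initial segment ending outside it contains the same
    levels. *)
Lemma vertex_x_cycled k : (k <= pip i1)%N || (pip i3 < k)%N ->
  vertex_x g pi' k = vertex_x g pip k.
Proof.
move=> kP; apply: eq_bigl => b.
case: (eqVneq b i1) => [->|b1]; first by rewrite cycled_order1; lia.
case: (eqVneq b i2) => [->|b2]; first by rewrite cycled_order2; lia.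
case: (eqVneq b i3) => [->|b3]; first by rewrite cycled_order3; lia.
by rewrite cycled_order_off.
Qed.

Lemma extreme_point_off a : a != i1 -> a != i2 -> a != i3 ->
  extreme_point g p pip pi' a = p a.
Proof.
move=> a1 a2 a3; rewrite /extreme_point cycled_order_off //.
have pos_neq b : a != b -> (pip a : nat) != pip b.
  by rewrite -(inj_eq (@perm_inj _ pip)).
have := pos_neq _ a1; have := pos_neq _ a2; have := pos_neq _ a3 => n3 n2 n1.
by rewrite !vertex_x_cycled ?thermo_curve_vertexS //; lia.
Qed.

(* Rise of the curve of p over an interval of length t starting where the
   segment of i1 starts. *)
Definition curve_rise (t : R) : R :=
  u i1 * Num.min (Num.max t 0) (g i1)
  + u i2 * Num.min (Num.max (t - g i1) 0) (g i2)
  + u i3 * Num.min (Num.max (t - g i1 - g i2) 0) (g i3).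

Lemma thermo_curve_rise t : 0 <= t -> t <= g i1 + g i2 + g i3 ->
  thermo_curve g p pip (x0 + t) = thermo_curve g p pip x0 + curve_rise t.
Proof.
move=> t0 tle; have [n12 n13 n23] := consecutive_neq.
have x1 : vertex_x g pip (pip i2) = x0 + g i1 by rewrite pos2 vertex_xS.
have x2 : vertex_x g pip (pip i3) = x0 + g i1 + g i2 by rewrite pos3 vertex_xS x1.
have x3 : vertex_x g pip (pip i3).+1 = x0 + g i1 + g i2 + g i3 by rewrite vertex_xS x2.
have pE a : p a = u a * g a by rewrite divfK ?lt0r_neq0.
rewrite thermo_curve_vertex big_mkcond /= /thermo_curve.
rewrite (bigD1 i1) // (bigD1 i2) 1?eq_sym //= (bigD1 i3) /=; last first.
  by rewrite ![i3 == _]eq_sym n13 n23.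
rewrite [in RHS](bigD1 i1) // [in RHS](bigD1 i2) 1?eq_sym //=.
rewrite [in RHS](bigD1 i3) /=; last by rewrite ![i3 == _]eq_sym n13 n23.
have -> : (pip i1 < pip i1)%N = false by lia.
have -> : (pip i2 < pip i1)%N = false by lia.
have -> : (pip i3 < pip i1)%N = false by lia.
rewrite x1 x2 -/x0 !(pE i1, pE i2, pE i3) -!mulrA !clamp01_div // /curve_rise.
rewrite (_ : x0 + t - x0 = t); last by ring.
rewrite (_ : x0 + t - (x0 + g i1) = t - g i1); last by ring.
rewrite (_ : x0 + t - (x0 + g i1 + g i2) = t - g i1 - g i2); last by ring.
rewrite !add0r !mulrA [RHS]addrC -!addrA; do 3 congr (_ + _).
(* Levels outside the block contribute equally at [x0] and [x0 + t]: fully if they precede it,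
   nothing if they follow it. *)
apply: eq_bigr => b /andP[/andP[b1 b2] b3].
have pos_neq c : b != c -> (pip b : nat) != pip c.
  by rewrite -(inj_eq (@perm_inj _ pip)).
have := pos_neq _ b1; have := pos_neq _ b2; have := pos_neq _ b3 => p3 p2 p1.
case: ltnP => bk; first by rewrite (clamp01_before bk) ?mulr1 // lerDl.
rewrite (@clamp01_after pip (pip i3).+1) ?mulr0 //; first lia.
by rewrite x3 -!addrA lerD2l addrA.
Qed.

End Curve.

Lemma root_rate_cvg0 (R : realType) (f : nat -> R) (K : R) :
  (forall n, (0 < n)%N -> `|f n| <= K / Num.sqrt n%:R) -> f @ \oo --> 0.
Proof.
move=> fK; apply/cvgrPdist_le => e e0.
near=> n; rewrite sub0r normrN.
have n0 : (0 < n)%N by near: n; exact: nbhs_infty_gt.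
have s0 : 0 < Num.sqrt n%:R :> R by rewrite sqrtr_gt0 ltr0n.
apply: le_trans (fK n n0) _; rewrite ler_pdivrMr // mulrC -ler_pdivrMr //.
(* Passing to the absolute value covers either sign of [K]; the threshold on n is [(K / e) ^+ 2]. *)
apply: le_trans (ler_norm _) _; rewrite -sqrtr_sqr ler_sqrt ?ler0n //.
near: n; exact: nbhs_infty_ger.
Unshelve. all: by end_near.
Qed.

(** * Matching the protocol with the extreme point *)

Section Main.
Variables (R : realType) (d : nat) (g p : 'I_d -> R).
Hypothesis g_gt0 : forall a, 0 < g a.
Variables (pip : 'S_d) (i1 i2 i3 : 'I_d).
Hypothesis pos3 : (pip i3 : nat) = (pip i2).+1.
Hypothesis pos2 : (pip i2 : nat) = (pip i1).+1.

Let pi' : 'S_d := (tperm i1 i3 * tperm i2 i3 * pip)%g.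
Let u a := p a / g a.
Let B := first_stage_limit (g i2) (g i3) (u i2) (u i3).
Let A := second_stage_limit (g i1) (g i2) (g i3) (u i1) (u i2) (u i3).

Let pE a : u a * g a = p a.
Proof. by rewrite divfK // lt0r_neq0. Qed.

Lemma vertex_x_cycled_start : vertex_x g pi' (pi' i3) = vertex_x g pip (pip i1).
Proof. by rewrite (cycled_order3 pos3 pos2) (vertex_x_cycled g pos3 pos2) ?leqnn. Qed.

Lemma vertex_x_cycled1 : vertex_x g pi' (pi' i1) = vertex_x g pip (pip i1) + g i3.
Proof.
rewrite -vertex_x_cycled_start -vertex_xS; congr vertex_x.
by rewrite cycled_order1 (cycled_order3 pos3 pos2) pos2.
Qed.

Lemma vertex_x_cycled2 :
  vertex_x g pi' (pi' i2) = vertex_x g pip (pip i1) + (g i3 + g i1).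
Proof.
rewrite addrA -vertex_x_cycled1 -vertex_xS; congr vertex_x.
by rewrite cycled_order1 (cycled_order2 pos3 pos2) pos3.
Qed.

Let Z := curve_rise g p i1 i2 i3.

(** Measuring length from the end of the segment of i1 turns the rise of the curve into the
    three-slope profile. *)
Lemma curve_rise_second_stage : Z (g i3) = A.
Proof.
have := (g_gt0 i1, g_gt0 i2, g_gt0 i3) => -[[g1 g2] g3].
rewrite /Z /curve_rise /A /second_stage_limit /profile -!/(u _).
rewrite (_ : Num.min (Num.max (g i3) 0) (g i1) = g i1 + Num.min (g i3 - g i1) 0).
  (* What spills past the first two segments is shorter than [g i3], so the cap is inactive. *)
  rewrite (_ : Num.min (Num.max (g i3 - g i1 - g i2) 0) (g i3) =
               Num.max (g i3 - g i1 - g i2) 0); first by ring.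
  by apply: min_l; case: (leP (g i3 - g i1 - g i2) 0) => ?; lra.
rewrite (max_l (ltW g3)).
by case: (leP (g i3) (g i1)); case: (leP (g i3 - g i1) 0) => ? ?; lra.
Qed.

(** The segment of i1 uses up length [g i1]; the remaining [g i3] runs through i2 and then i3, as in
    the two-slope profile. *)
Lemma curve_rise_first_stage : Z (g i3 + g i1) = p i1 + B.
Proof.
have := (g_gt0 i1, g_gt0 i2, g_gt0 i3) => -[[g1 g2] g3].
rewrite /Z /curve_rise /B /first_stage_limit /profile -!/(u _) -(pE i1) addrK subr0.
rewrite (_ : Num.min (Num.max (g i3 + g i1) 0) (g i1) = g i1).
  rewrite (_ : Num.min (Num.max (g i3) 0) (g i2) = g i2 + Num.min (g i3 - g i2) 0).
    rewrite (_ : Num.min (Num.max (g i3 - g i2) 0) (g i3) = Num.max (g i3 - g i2) 0).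
      rewrite (_ : Num.min (Num.max (g i3 - g i2) 0) 0 = 0); first by ring.
      by apply: min_r; rewrite le_max lexx orbT.
    by apply: min_l; case: (leP (g i3 - g i2) 0) => ?; lra.
  rewrite (max_l (ltW g3)).
  by case: (leP (g i3) (g i2)); case: (leP (g i3 - g i2) 0) => ? ?; lra.
by apply: min_r; rewrite max_l; lra.
Qed.

Lemma curve_rise_total : Z (g i3 + g i1 + g i2) = p i1 + p i2 + p i3.
Proof.
have := (g_gt0 i1, g_gt0 i2, g_gt0 i3) => -[[g1 g2] g3].
rewrite /Z /curve_rise -!/(u _) -!pE; congr (_ * _ + _ * _ + _ * _).
- by apply: min_r; rewrite max_l; lra.
- by apply: min_r; rewrite max_l; lra.
- by rewrite max_l ?min_r; lra.
Qed.

(** In the order i3, i1, i2 the extreme point collects successive increments of [Z], at lengths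
    [g i3], [g i3 + g i1] and the whole block. *)
Lemma extreme_point3 : extreme_point g p pip pi' i3 = A.
Proof.
have := (g_gt0 i1, g_gt0 i2, g_gt0 i3) => -[[g1 g2] g3].
rewrite /extreme_point vertex_xS vertex_x_cycled_start.
rewrite (thermo_curve_rise p g_gt0 pos3 pos2) //; last by lra.
  by rewrite addrC addKr -/Z curve_rise_second_stage.
exact: ltW.
Qed.

Lemma extreme_point1 : extreme_point g p pip pi' i1 = p i1 + B - A.
Proof.
have := (g_gt0 i1, g_gt0 i2, g_gt0 i3) => -[[g1 g2] g3].
rewrite /extreme_point vertex_xS vertex_x_cycled1 -addrA.
rewrite !(thermo_curve_rise p g_gt0 pos3 pos2); [|lra..].
by rewrite -/Z curve_rise_second_stage curve_rise_first_stage; ring.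
Qed.

Lemma extreme_point2 : extreme_point g p pip pi' i2 = p i2 + p i3 - B.
Proof.
have := (g_gt0 i1, g_gt0 i2, g_gt0 i3) => -[[g1 g2] g3].
rewrite /extreme_point vertex_xS vertex_x_cycled2 -addrA.
rewrite !(thermo_curve_rise p g_gt0 pos3 pos2); [|lra..].
by rewrite -/Z curve_rise_total curve_rise_first_stage; ring.
Qed.

Section Memory.
Variable N : nat.
Hypothesis N_gt0 : (0 < N)%N.

Let G : joint d N -> R := joint_gibbs g.
Let Q1 := protocol G i2 i3 (tensor p).
Let Q2 := protocol G i1 i3 Q1.
Let c1 := grid (g i2) (g i3) (u i2) (fun=> u i3) ^~ N.
Let c2 := grid (g i1) (g i3) (u i1) (fun k => c1 k.+1) ^~ N.

Let G_gt0 z : 0 < G z.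
Proof. by rewrite divr_gt0 ?ltr0n. Qed.

Lemma marginal_tensor (q : 'I_d -> R) a : marginal (tensor (N := N) q) a = q a.
Proof.
rewrite /marginal /tensor /eta_M /= sumr_const card_ord -mulrnAr -mulr_natr mulVf ?mulr1 //.
by rewrite pnatr_eq0 -lt0n.
Qed.

Let tensorE a (k : 'I_N) : tensor p (a, k) = g a / N%:R * u a.
Proof. by rewrite /tensor /eta_M /= -(pE a); ring. Qed.

Lemma first_stage_population k : Q1 (i3, k) = g i3 / N%:R * c1 k.+1.
Proof.
have [n12 n13 n23] := consecutive_neq pos3 pos2.
exact: (protocol_grid g_gt0 N_gt0 n23 (tensorE i2) (u := fun=> u i3) (tensorE i3)).
Qed.

Lemma second_stage_population k : Q2 (i3, k) = g i3 / N%:R * c2 k.+1.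
Proof.
have [n12 n13 n23] := consecutive_neq pos3 pos2.
apply: (protocol_grid g_gt0 N_gt0 n13 (u := fun k => c1 k.+1)) => [l|m].
  (* The first protocol leaves i1 untouched, so its copies still have the constant ratio [u i1]. *)
  by rewrite /Q1 protocol_off // tensorE.
exact: first_stage_population.
Qed.

Lemma marginal_protocol_off (i j a : 'I_d) (Q : joint d N -> R) : a != i -> a != j ->
  marginal (protocol G i j Q) a = marginal Q a.
Proof. by move=> ai aj; apply: eq_bigr => k _; rewrite protocol_off. Qed.

(** By conservation the errors b - B and a - A of the two i3 populations fix all others: i1 is off
    by (b - B) - (a - A), i2 by -(b - B), i3 by a - A, and the remaining levels are exact. The
    factor 1/2 absorbs the double counting. *)
Lemma tv_dist_stages :
  tv_dist (marginal (protocol_Pi (N := N) g i1 i2 i3 (tensor p))) (extreme_point g p pip pi')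
  <= `|g i3 / N%:R * (\sum_(k < N) c1 k.+1) - B|
   + `|g i3 / N%:R * (\sum_(k < N) c2 k.+1) - A|.
Proof.
have [n12 n13 n23] := consecutive_neq pos3 pos2.
rewrite /protocol_Pi /mem_therm -/G -/Q1 -/Q2.
have q3 : marginal Q2 i3 = g i3 / N%:R * (\sum_(k < N) c2 k.+1).
  by rewrite mulr_sumr; apply: eq_bigr => k _; rewrite second_stage_population.
have r3 : marginal Q1 i3 = g i3 / N%:R * (\sum_(k < N) c1 k.+1).
  by rewrite mulr_sumr; apply: eq_bigr => k _; rewrite first_stage_population.
have q2 : marginal Q2 i2 = p i2 + p i3 - marginal Q1 i3.
  rewrite marginal_protocol_off // 1?eq_sym //.
  have := protocol_marginal G_gt0 n23 (tensor p).
  by rewrite !marginal_tensor -/Q1 => <-; rewrite addrK.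
have q1 : marginal Q2 i1 = p i1 + marginal Q1 i3 - marginal Q2 i3.
  have := protocol_marginal G_gt0 n13 Q1.
  rewrite -/Q2 [marginal Q1 i1]marginal_protocol_off // marginal_tensor => <-.
  by rewrite addrK.
rewrite -q3 -r3 /tv_dist.
rewrite (bigD1 i1) // (bigD1 i2) 1?eq_sym //= (bigD1 i3) /=; last first.
  by rewrite ![i3 == _]eq_sym n13 n23.
rewrite big1 => [|a /andP[/andP[a1 a2] a3]]; last first.
  rewrite marginal_tensor !marginal_protocol_off // marginal_tensor.
  by rewrite (extreme_point_off p g_gt0 pos3 pos2) // subrr normr0.
rewrite !marginal_tensor extreme_point1 extreme_point2 extreme_point3 q1 q2 addr0.
set b := marginal Q1 i3; set a := marginal Q2 i3.
rewrite (_ : _ - (p i1 + B - A) = (b - B) - (a - A)); last by ring.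
rewrite (_ : _ - (p i2 + p i3 - B) = - (b - B)); last by ring.
rewrite normrN; have := ler_normB (b - B) (a - A).
lra.
Qed.

End Memory.

Lemma tv_dist_rate : exists K, forall N, (0 < N)%N ->
  `|tv_dist (marginal (protocol_Pi (N := N) g i1 i2 i3 (tensor p)))
      (extreme_point g p pip pi')| <= K / Num.sqrt N%:R.
Proof.
have [K1 H1] := first_stage_rate (u i2) (u i3) (g_gt0 i2) (g_gt0 i3).
have [K2 H2] := second_stage_rate (u i1) (u i2) (u i3) (g_gt0 i1) (g_gt0 i2) (g_gt0 i3).
exists (K1 + K2) => N N0; rewrite ger0_norm; last by rewrite mulr_ge0 ?sumr_ge0.
apply: le_trans (tv_dist_stages N0) _.
by rewrite mulrDl lerD ?H1 ?H2.
Qed.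

End Main.

Lemma gibbs_gt0 (R : realType) (d : nat) (beta : R) (E : 'I_d -> R) a : 0 < gibbs beta E a.
Proof.
rewrite divr_gt0 ?expR_gt0 // (bigD1 a) //= ltr_wpDr ?expR_gt0 //.
by apply: sumr_ge0 => b _; apply: expR_ge0.
Qed.

Theorem theorem3 (R : realType) (d : nat) (beta : R) (E : 'I_d -> R)
    (p : 'I_d -> R) (pip : 'S_d) (i1 i2 i3 : 'I_d) :
  (3 <= d)%N -> 0 < beta -> is_prob p ->
  is_beta_order (gibbs beta E) p pip ->
  (pip i3 : nat) = (pip i2).+1 -> (pip i2 : nat) = (pip i1).+1 ->
  let g := gibbs beta E in
  let pi' : 'S_d := (tperm i1 i3 * tperm i2 i3 * pip)%g in
  let q := fun N : nat =>
     marginal (protocol_Pi (N := N) g i1 i2 i3 (tensor p)) in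
  (forall N : nat, (0 < N)%N ->
     protocol_Pi (N := N) g i1 i2 i3 (tensor p) = tensor (q N)) /\
  (fun N : nat => tv_dist (q N) (extreme_point g p pip pi')) @ \oo --> 0.
Proof.
move=> _ _ _ _ pos3 pos2 g pi' q; split=> [N N0|].
  by rewrite /q /protocol_Pi /mem_therm; apply/funext => z; rewrite /tensor marginal_tensor.
have [K HK] := tv_dist_rate p (gibbs_gt0 beta E) pos3 pos2.
exact: root_rate_cvg0 HK.
Qed.
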